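(* Let $G=(V,w,m)$ be an infinite, connected, normalized linear graph satisfying $\mathrm{CD}(0,D)$ for some $D\in[4,\infty)$. Then $G$ satisfies the volume doubling property $\mathcal{VD}(2^{D-1})$, i.e. $$m(B_{2R}(x))\le 2^{D-1}\,m(B_R(x))\quad\text{for all }x\in V\text{ and all }R\in\mathbb{R}_+ .$$
   Context: A weighted graph $G=(V,E,w,m)$ is a connected, undirected, simple, locally finite graph $(V,E)$ with vertex weights $m:V\to(0,\infty)$ and symmetric edge weights $w:E\to(0,\infty)$, $w(x,y)=w(y,x)$ (with $w(x,y)=0$ if $x\not\sim y$). It is normalized if $m(x)=\sum_{y\sim x}w(x,y)$ for all $x\in V$. It is a linear graph if $V=\mathbb{Z}\cap I$ for a (bounded or unbounded) interval $I\subset\mathbb{R}$ and $E=\{\{n,n+1\}: n,n+1\in V\}$. $B_R(x)=\{y\in V:d(x,y)\le R\}$ is the ball with respect to the combinatorial graph distance $d$, and $m(A)=\sum_{x\in A}m(x)$. The Laplacian is $\Delta f(x)=\frac1{m(x)}\sum_{y\sim x}w(x,y)(f(y)-f(x))$ for $f:V\to\mathbb{R}$. Set $\Gamma(f,g)=\frac12(\Delta(fg)-f\Delta g-g\Delta f)$, $\Gamma(f)=\Gamma(f,f)$, and $\Gamma_2(f)=\frac12\Delta\Gamma(f)-\Gamma(f,\Delta f)$. For $K\in\mathbb{R}$, $D\in(0,\infty]$ (with $1/\infty=0$) and $x\in V$, the condition $\mathrm{CD}(K,D,x)$ means $\Gamma_2(f)(x)\ge\frac1D(\Delta f(x))^2+K\,\Gamma(f)(x)$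 for all $f:V\to\mathbb{R}$; $\mathrm{CD}(K,D)$ means that $\mathrm{CD}(K,D,x)$ holds for all $x\in V$. *)

(* Defs.v *)
From HB Require Import structures.
From mathcomp Require Import all_boot all_order all_algebra.
From mathcomp Require Import all_classical all_reals all_analysis.

Set Implicit Arguments.
Unset Strict Implicit.
Unset Printing Implicit Defensive.

Import Order.TTheory GRing.Theory Num.Theory.

Local Open Scope classical_set_scope.
Local Open Scope ring_scope.

Definition walk (V : eqType) (e : rel V) (x y : V) (n : nat) : Prop :=
  exists p : seq V, [/\ path e x p, last x p = y & size p = n].

Record wgraph (R : realType) (V : choiceType) := WGraph {
  adj : rel V;
  weight : V -> V -> R;
  mass : V -> R;
  adj_sym : symmetric adj;
  adj_irr : irreflexive adj;
  adj_finite : forall x, finite_set [set y | adj x y];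
  adj_connected : forall x y, exists n, `[< walk adj x y n >];
  weight_sym : forall x y, weight x y = weight y x;
  weight_gt0 : forall x y, adj x y -> 0 < weight x y;
  weight_eq0 : forall x y, ~~ adj x y -> weight x y = 0;
  mass_gt0 : forall x, 0 < mass x
}.

Section WeightedGraph.
Variables (R : realType) (V : choiceType) (G : wgraph R V).
Implicit Types (f g : V -> R) (x y : V).

Definition normalized : Prop :=
  forall x, mass G x = \sum_(y \in [set y | adj G x y]) weight G x y.

Definition gdist x y : nat := ex_minn (adj_connected G x y).

Definition gball (r : R) x : set V := [set y | (gdist x y)%:R <= r].

Definition vol (A : set V) : \bar R := \esum_(x in A) (mass G x)%:E.

Definition laplacian f x : R :=
  (mass G x)^-1 *
  \sum_(y \in [set y | adj G x y]) (weight G x y * (f y - f x)).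

Definition carre f g x : R :=
  2^-1 * (laplacian (fun z => f z * g z) x
          - f x * laplacian g x - g x * laplacian f x).

Definition carre2 f x : R :=
  2^-1 * laplacian (carre f f) x - carre f (laplacian f) x.

(* 1/D for D in (0, +oo], with 1/oo = 0 *)
Definition inv_dim (D : \bar R) : R := if D is r%:E then r^-1 else 0.

Definition CD_at (K : R) (D : \bar R) x : Prop :=
  forall f, inv_dim D * laplacian f x ^+ 2 + K * carre f f x <= carre2 f x.

Definition CD (K : R) (D : \bar R) : Prop := forall x, CD_at K D x.

Definition volume_doubling (C : R) : Prop :=
  forall x (r : R), 0 <= r ->
    (vol (gball (2 * r) x) <= C%:E * vol (gball r x))%E.

End WeightedGraph.

Definition int_in (R : realType) (I : interval R) : choiceType :=
  {n : int | (n%:~R : R) \in I}.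

Definition linear_graph (R : realType) (I : interval R)
    (G : wgraph R (int_in I)) : Prop :=
  forall x y : int_in I,
    adj G x y = (sval y == sval x + 1) || (sval x == sval y + 1).

(* Main.v *)
(** Write [w n] for the weight of the edge {n, n+1}, [m n = w n + w (n-1)], and
let the drift be [d n = (w n - w (n-1)) / m n], [L = D - 2] and
[kap = 1 - 2/D = L/(L+2)].  Testing CD(0,D) at [n] with functions that are linear
on each side of [n] gives a nonnegative binary quadratic form in the two slopes,
hence the inequality
  [0 <= - d (n+1) d (n-1) + kap/2 (d (n-1) (1 + d n) - d (n+1) (1 - d n))]
together with two one-sided bounds.  Equality holds for [L / (L + 2 n)], the
drift of the weights binomial(n+L, n) on the half-line, and the inequality
propagates the bound [d n <= L / (L + 2 n)] from two consecutive vertices to the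
next one.  Run from a far away vertex towards a given one, it shows that the drift
cannot point away from an infinite end.  So on the two-sided line [m] is
constant, while on the half-line starting at 0 [m] is nondecreasing and, since
[L >= 2], [m n / (n+1)^L] is nonincreasing.  In particular [m j <= 2^L m i] whenever
[j + 1 <= 2 (i + 1)].

Let [x] be a vertex of the half-line; a ball of radius [2r] is contained in the one of
radius [2k+1] where [k] is the integer part of [r].  If [x < k], then sending [j] to [j/2] maps
the ball of radius [2k+1] two-to-one into the ball of radius [k], which gives the
factor [2 * 2^L].  If [k <= x], the ball of radius [2k+1] is the ball of radius [k],
a left part whose translate by [k+1] lies in the ball of radius [k], and a right part
whose translate by [-(k+1)] does, whence the factor [2 + 2^L <= 2 * 2^L]. *)
Require Import Defs.
From HB Require Import structures.
From mathcomp Require Import all_boot all_order all_algebra.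
From mathcomp Require Import all_classical all_reals all_analysis.
From mathcomp Require Import ring lra zify.

Set Implicit Arguments.
Unset Strict Implicit.
Unset Printing Implicit Defensive.

Import Order.TTheory GRing.Theory Num.Theory.

Local Open Scope classical_set_scope.
Local Open Scope ring_scope.

(** * The model drift and its recurrence *)

Section DriftBound.
Variables (R : realType) (L : R).
Hypothesis L2 : 2 <= L.

Let kap : R := L / (L + 2).

(* The drift of the half-line with edge weights binomial(j + L, j), for which the
   curvature condition is an equality. *)
Definition drift_bound (j : nat) : R := L / (L + 2 * j%:R).

Local Notation b := drift_bound.

Let den_gt0 j : 0 < L + 2 * j%:R.
Proof. by have : 0 <= j%:R :> R by []; have := L2; lra. Qed.

Lemma drift_bound_gt0 j : 0 < b j.
Proof. by rewrite divr_gt0 //; have := L2; lra. Qed.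

Lemma drift_bound0 : b 0 = 1.
Proof. by rewrite /b mulr0 addr0 divff// gt_eqF//; have := L2; lra. Qed.

Lemma drift_bound1 : b 1 = kap.
Proof. by rewrite /b mulr1. Qed.

Lemma kap_gt0 : 0 < kap.
Proof. by rewrite -drift_bound1 drift_bound_gt0. Qed.

(** Equality in the curvature inequality at three consecutive values of the model drift, arranged as
    an equation for the third. *)
Lemma drift_bound_recurrence j :
  b j.+2 * (b j + kap * (1 - b j.+1) / 2) = kap * (1 + b j.+1) / 2 * b j.
Proof.
have h0 := den_gt0 j; have h1 := den_gt0 j.+1; have h2 := den_gt0 j.+2.
have h3 : L + 2 != 0 by rewrite gt_eqF//; have := L2; lra.
rewrite /b /kap; move: h0 h1 h2; rewrite -!natr1 => h0 h1 h2.
field; rewrite h3 !gt_eqF//=; lra.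
Qed.

(** The last hypothesis reads [w (u + kap (1 - v) / 2) <= kap (1 + v) u / 2]. For [u > 0] the bound
    on [w] that this gives increases with [u] and [v], and at [b j], [b j.+1] the recurrence turns
    it into [b j.+2]. *)
Lemma drift_bound_step j (u v w : R) : -1 < v -> v < 1 ->
    u <= b j -> v <= b j.+1 -> - u <= kap * (1 - v) / 2 ->
    0 <= - (w * u) + kap / 2 * (u * (1 + v) - w * (1 - v)) ->
  w <= b j.+2.
Proof.
move=> v1 v2 ub vb Hu H.
have k0 := kap_gt0.
have b0 := drift_bound_gt0 j; have b1 := drift_bound_gt0 j.+1; have b2 := drift_bound_gt0 j.+2.
rewrite leNgt; apply/negP => wb.
have E := drift_bound_recurrence j.
move: k0 b0 b1 b2 E ub vb wb Hu H.
move: (kap) (b j) (b j.+1) (b j.+2) => K B0 B1 B2 k0 b0 b1 b2 E ub vb wb Hu H.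
(* For [u <= 0] the two parts of [H], [- w (u + K (1 - v) / 2)] and [K (1 + v) u / 2], are
   nonpositive. Hence [u = 0], and then the first part is negative. *)
have [u0|u0] := leP u 0.
  have w0 : 0 < w by exact: lt_trans wb.
  have X1 : 0 <= w * (K * (1 - v) / 2 + u) by rewrite mulr_ge0 ?(ltW w0)//; lra.
  have X2 : 0 <= - u * (K * (1 + v)) by rewrite !mulr_ge0// ?(ltW k0)//; lra.
  have u00 : u = 0.
    apply/eqP; rewrite eq_le u0 leNgt; apply/negP => un.
    have : 0 < - u * (K * (1 + v)) by rewrite !mulr_gt0//; lra.
    by lra.
  have : 0 < w * (K * (1 - v)) by rewrite !mulr_gt0//; lra.
  by move: H; rewrite u00; lra.
have X1 : B2 * (u + K * (1 - v) / 2) < K * (1 + v) / 2 * u.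
  apply: (@lt_le_trans _ _ (w * (u + K * (1 - v) / 2))); last by lra.
  rewrite ltr_pM2r// addr_gt0// divr_gt0// mulr_gt0//; lra.
have X2 : 0 < K * (1 + v) / 2 - B2.
  rewrite -(pmulr_lgt0 _ u0).
  have : 0 < B2 * (K * (1 - v) / 2) by rewrite !mulr_gt0//; lra.
  by lra.
(* [X3] and [X4] raise [u] to [B0] and [v] to [B1] in the strict inequality [X1], which then
   contradicts [E]. *)
have X3 : 0 <= (B0 - u) * (K * (1 + v) / 2 - B2).
  by rewrite mulr_ge0//; lra.
have X4 : 0 <= (B1 - v) * (K * (B0 + B2)).
  by rewrite !mulr_ge0//; lra.
lra.
Qed.

(** The left side is the ratio of consecutive masses in the model. Writing [L = 2 + e] isolates the
    square, so that a first-order bound on the power [e] suffices. *)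
Lemma drift_bound_ratio_le_powR (j : nat) :
  (1 + b j) / (1 - b j.+1) <= ((j.+2%:R / j.+1%:R : R) `^ L).
Proof.
set t : R := j.+1%:R; have t1 : 1 <= t by rewrite ler1n.
have -> : j.+2%:R = t + 1 :> R by rewrite natr1.
have jt : j%:R = t - 1 :> R by rewrite /t -natr1; lra.
pose e := L - 2; have e0 : 0 <= e by have := L2; rewrite /e; lra.
have LE : L = 2 + e by rewrite /e; lra.
have bj : (1 + b j) / (1 - b j.+1) = (t + 1 + e) * (2 * t + 2 + e) / ((2 * t + e) * t).
  rewrite /b -/t jt LE; field.
  by rewrite !gt_eqF//=; lra.
have x1 : 0 < (t + 1) / t by rewrite divr_gt0//; lra.
have xn : (t + 1) / t != 0 by rewrite gt_eqF.
rewrite bj LE powRD; last by rewrite xn implybT.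
(* Combines [expR z >= 1 + z] with [ln ((t + 1) / t) >= 1 / (t + 1)]. *)
have P : 1 + e * (t + 1)^-1 <= ((t + 1) / t) `^ e.
  rewrite /powR (negbTE xn).
  apply: (le_trans _ (expR_ge1Dx _)).
  rewrite lerD2l ler_wpM2l//.
  have -> : (t + 1) / t = (t / (t + 1))^-1 by rewrite invf_div.
  rewrite lnV ?posrE ?divr_gt0//; try lra.
  rewrite lerNr.
  have -> : t / (t + 1) = 1 + (- (t+1)^-1) by field; rewrite gt_eqF//; lra.
  apply: le_ln1Dx.
  by rewrite ltrN2 invf_lt1; lra.
rewrite powR_mulrn; last exact: ltW.
apply: (@le_trans _ _ (((t + 1) / t) ^+ 2 * (1 + e * (t + 1)^-1))); last first.
  by rewrite ler_wpM2l// exprn_ge0// ltW.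
rewrite -subr_ge0.
have -> : ((t + 1) / t) ^+ 2 * (1 + e / (t + 1)) - (t + 1 + e) * (2 * t + 2 + e) / ((2 * t + e) * t)
   = (t + 1 + e) * e / (t ^+ 2 * (2 * t + e)).
  by field; rewrite !gt_eqF//=; lra.
rewrite divr_ge0// mulr_ge0//; try lra.
by rewrite exprn_ge0//; lra.
Qed.

End DriftBound.

(** * Mass, drift and the curvature condition on the integers *)

Definition line_mass (R : realType) (W : int -> R) (n : int) : R := W n + W (n - 1).

Definition line_drift (R : realType) (W : int -> R) (n : int) : R :=
  (W n - W (n - 1)) / line_mass W n.

(* [P] is the vertex set and [W n] the weight of the edge {n, n + 1}, taken to be 0 if
   that edge is missing.  The last three fields say that the quadratic form which
   CD(0,D) yields, with [kap = 1 - 2/D], is positive semidefinite: its diagonal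
   coefficients and, up to a positive factor, its determinant. *)
Record line_CD (R : realType) (kap : R) (P : pred int) (W : int -> R) : Prop := LineCD {
  line_edge_gt0 : forall n, P n -> P (n + 1) -> 0 < W n;
  line_edge_eq0 : forall n, ~~ (P n && P (n + 1)) -> W n = 0;
  line_mass_gt0 : forall n, P n -> 0 < line_mass W n;
  line_drift_upper : forall n, P n -> P (n + 1) ->
    line_drift W (n + 1) <= kap * (1 + line_drift W n) / 2;
  line_drift_lower : forall n, P n -> P (n - 1) ->
    - line_drift W (n - 1) <= kap * (1 - line_drift W n) / 2;
  line_drift_ineq : forall n, P (n - 1) -> P n -> P (n + 1) ->
    0 <= - (line_drift W (n + 1) * line_drift W (n - 1))
         + kap / 2 * (line_drift W (n - 1) * (1 + line_drift W n)
                      - line_drift W (n + 1) * (1 - line_drift W n))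
}.

Section LineDrift.
Variables (R : realType) (kap : R).
Implicit Types (P : pred int) (W : int -> R).

(** The map [n -> - n] sends the edge {n, n + 1} to an edge whose left end is [- n - 1]. *)
Definition reflect_edge W (n : int) : R := W (- n - 1).

Lemma line_mass_reflect W n : line_mass (reflect_edge W) n = line_mass W (- n).
Proof.
rewrite /line_mass /reflect_edge addrC; congr (W _ + W _).
by rewrite opprB addrAC subrr sub0r.
Qed.

Lemma line_drift_reflect W n : line_drift (reflect_edge W) n = - line_drift W (- n).
Proof.
rewrite /line_drift line_mass_reflect -mulNr; congr (_ / _).
by rewrite /reflect_edge opprB opprB addrAC subrr sub0r.
Qed.

Lemma line_CD_reflect P W : line_CD kap P W ->
  line_CD kap (fun n => P (- n)) (reflect_edge W).
Proof.
case=> W1 W2 W3 W4 W5 W6; split => n /=.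
- rewrite opprD => Pn Pn1; apply: W1 => //.
  by rewrite subrK.
- rewrite opprD => H; apply: W2; rewrite subrK andbC//.
- by rewrite line_mass_reflect => Pn; apply: W3.
- rewrite !line_drift_reflect opprD => Pn Pn1; exact: W5.
- rewrite !line_drift_reflect !opprD !opprK => Pn Pn1; exact: W4.
- rewrite !line_drift_reflect !opprD !opprK => P1 P2 P3.
  have := W6 (- n) P3 P2 P1; lra.
Qed.

Section Fixed.
Variables (P : pred int) (W : int -> R).
Hypothesis PW : line_CD kap P W.

Lemma line_edge_ge0 n : 0 <= W n.
Proof.
have [/andP[P1 P2]|H] := boolP (P n && P (n + 1)).
  by rewrite ltW// (line_edge_gt0 PW).
by rewrite (line_edge_eq0 PW).
Qed.

Lemma line_mass_ge0 n : 0 <= line_mass W n.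
Proof. by rewrite addr_ge0// line_edge_ge0. Qed.

Lemma line_mass_eq0 n : ~~ P n -> line_mass W n = 0.
Proof.
move=> Pn; rewrite /line_mass !(line_edge_eq0 PW) ?addr0//.
  by rewrite subrK (negbTE Pn) andbF.
by rewrite (negbTE Pn).
Qed.

Lemma edge_right_drift n : P n -> W n = line_mass W n * (1 + line_drift W n) / 2.
Proof.
move=> Pn; rewrite /line_drift; have := line_mass_gt0 PW Pn; rewrite /line_mass => M0.
by field; rewrite gt_eqF.
Qed.

Lemma edge_left_drift n : P n -> W (n - 1) = line_mass W n * (1 - line_drift W n) / 2.
Proof.
move=> Pn; rewrite /line_drift; have := line_mass_gt0 PW Pn; rewrite /line_mass => M0.
by field; rewrite gt_eqF.
Qed.

Lemma line_drift_le1 n : P n -> line_drift W n <= 1.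
Proof.
move=> Pn; have := line_edge_ge0 (n - 1); rewrite edge_left_drift//.
have M0 := line_mass_gt0 PW Pn.
by rewrite -mulrA pmulr_rge0//; lra.
Qed.

Lemma line_drift_lt1 n : P n -> P (n - 1) -> line_drift W n < 1.
Proof.
move=> Pn Pn1; have := line_edge_gt0 PW Pn1; rewrite subrK edge_left_drift// => /(_ Pn).
have M0 := line_mass_gt0 PW Pn.
by rewrite -mulrA pmulr_rgt0//; lra.
Qed.

End Fixed.

Lemma line_drift_gtN1 P W n : line_CD kap P W -> P n -> P (n + 1) -> -1 < line_drift W n.
Proof.
move=> PW Pn Pn1; have := @line_drift_lt1 _ _ (line_CD_reflect PW) (- n).
by rewrite line_drift_reflect opprB !opprK addrC ltrNl; apply.
Qed.

Lemma line_drift_geN1 P W n : line_CD kap P W -> P n -> -1 <= line_drift W n.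
Proof.
move=> PW Pn; have := @line_drift_le1 _ _ (line_CD_reflect PW) (- n).
by rewrite line_drift_reflect !opprK lerNl; apply.
Qed.

End LineDrift.

(** * Sets of integers closed under the successor, with a first element *)

Section RightClosed.
Variables (P : pred int) (c : int).
Hypotheses (Pr : forall n, P n -> P (n + 1)) (Pc : P c) (Pc1 : ~~ P (c - 1)).

Lemma rooted_mem (j : nat) : P (c + j%:Z).
Proof.
elim: j => [|j IH]; first by rewrite addr0.
by rewrite intS [1 + _]addrC addrA Pr.
Qed.

Lemma rooted_ge (n : int) : P n -> c <= n.
Proof.
clear Pc; rewrite leNgt => Pn; apply/negP => nc; move/negP: Pc1; apply.
have -> : c - 1 = n + (absz (c - 1 - n)%R)%:Z by lia.
elim: (absz _) => [|k IH]; first by rewrite addr0.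
by rewrite intS [1 + _]addrC addrA Pr.
Qed.

End RightClosed.

(** * Drift and mass bounds towards an infinite right end *)

Section HalfLine.
Variables (R : realType) (L : R).
Hypothesis L2 : 2 <= L.
Let kap : R := L / (L + 2).
Variables (P : pred int) (W : int -> R).
Hypothesis PW : line_CD kap P W.

(** [drift_bound_step] is applied to the negated drifts, read from right to left. Since vertices
    never run out on the right, any number [j] of steps can precede [n]. *)
Lemma line_drift_ge_bound : (forall n, P n -> P (n + 1)) ->
  forall j n, P n -> - line_drift W n <= drift_bound L j.
Proof.
move=> Pr j.
(* The recurrence has order two, so the induction carries two consecutive bounds. *)
suff H : forall n, P n -> - line_drift W n <= drift_bound L j /\
    - line_drift W n <= drift_bound L j.+1 by move=> n /H[].
elim: j => [n Pn|j IH n Pn].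
  rewrite drift_bound0// drift_bound1//; split.
    by rewrite lerNl (line_drift_geN1 PW).
  have P1 := Pr _ Pn.
  have := line_drift_lower PW P1; rewrite addrK => /(_ Pn) H.
  apply: le_trans H _.
  have := line_drift_geN1 PW P1.
  have := kap_gt0 L2; rewrite -/kap => k0 H.
  have : 0 <= kap * (1 + line_drift W (n + 1)) by rewrite mulr_ge0//; lra.
  by rewrite -/kap; lra.
split; first by case: (IH n Pn).
have P1 := Pr _ Pn; have P2 := Pr _ P1.
apply: (@drift_bound_step _ _ L2 j (- line_drift W (n + 1 + 1)) (- line_drift W (n + 1))).
- by rewrite ltrN2 (line_drift_lt1 PW)// addrK.
- by rewrite ltrNl (line_drift_gtN1 PW).
- by case: (IH _ P2).
- by case: (IH _ P1).
- by rewrite !opprK (line_drift_upper PW).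
- have := line_drift_ineq PW (n := n + 1); rewrite addrK => /(_ Pn P1 P2).
  by rewrite -/kap; lra.
Qed.

(** The bound [L / (L + 2 j)] tends to 0; a drift [- e < 0] already violates it for [j > L / e]. *)
Lemma line_drift_ge0 n : (forall n, P n -> P (n + 1)) -> P n -> 0 <= line_drift W n.
Proof.
move=> Pr Pn; rewrite leNgt; apply/negP => dn.
have L0 : 0 < L by have := L2; lra.
set e := - line_drift W n; have e0 : 0 < e by rewrite oppr_gt0.
have := line_drift_ge_bound Pr (Num.truncn (L / e)).+1 Pn; rewrite -/e.
have LE : L / e < (Num.truncn (L / e)).+1%:R by rewrite -truncn_le_nat.
move: LE; set j := _.+1%:R : R => LE.
have j0 : 0 <= j by [].
rewrite /drift_bound -/j ler_pdivlMr; last by lra.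
move: LE; rewrite ltr_pdivrMr// => LE.
have : 0 < e * L by rewrite mulr_gt0.
lra.
Qed.

Lemma line_mass_step n : P n -> P (n + 1) ->
  line_mass W (n + 1) * (1 - line_drift W (n + 1)) = line_mass W n * (1 + line_drift W n).
Proof.
move=> Pn Pn1; have := edge_left_drift PW Pn1; have := edge_right_drift PW Pn.
by rewrite addrK => ->; lra.
Qed.

Hypothesis Pr : forall n, P n -> P (n + 1).

Lemma line_mass_le n : line_mass W n <= line_mass W (n + 1).
Proof.
have [Pn|Pn] := boolP (P n); last by rewrite (line_mass_eq0 PW Pn) (line_mass_ge0 PW).
have Pn1 := Pr Pn; have E := line_mass_step Pn Pn1.
have d0 := line_drift_ge0 Pr Pn; have d1 := line_drift_ge0 Pr Pn1.
have M0 := line_mass_gt0 PW Pn; have M1 := line_mass_gt0 PW Pn1.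
have := mulr_ge0 (ltW M0) d0; have := mulr_ge0 (ltW M1) d1; lra.
Qed.

Lemma line_mass_homo (m n : int) : (m <= n) -> line_mass W m <= line_mass W n.
Proof.
move=> mn; have [k ->] : exists k : nat, n = m + k%:Z.
  by exists (absz (n - m)%R); lia.
elim: k => [|k IH]; first by rewrite addr0.
by apply: (le_trans IH); rewrite intS [1 + _]addrC addrA line_mass_le.
Qed.

Section Rooted.
Variable c : int.
Hypotheses (Pc : P c) (Pc1 : ~~ P (c - 1)).

(** The same recursion read from left to right. It starts at the first vertex with the trivial bound
    1, and [line_drift_upper] gives [kap] at the second. *)
Lemma rooted_drift_le (j : nat) : line_drift W (c + j%:Z) <= drift_bound L j.
Proof.
suff : line_drift W (c + j%:Z) <= drift_bound L j /\
    line_drift W (c + j.+1%:Z) <= drift_bound L j.+1 by case.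
have S i : c + i.+1%:Z = c + i%:Z + 1 by lia.
elim: j => [|j [IH1 IH2]].
  rewrite drift_bound0// drift_bound1// S addr0; split; first exact: (line_drift_le1 PW).
  apply: le_trans (line_drift_upper PW Pc (Pr Pc)) _.
  have := line_drift_le1 PW Pc.
  have := kap_gt0 L2; rewrite -/kap => k0 H.
  have : 0 <= kap * (1 - line_drift W c) by rewrite mulr_ge0//; lra.
  by rewrite -/kap; lra.
split=> //; have P0 := rooted_mem Pr Pc j; have P1 := rooted_mem Pr Pc j.+1.
have P2 := rooted_mem Pr Pc j.+2.
have S1 : c + j%:Z = c + j.+1%:Z - 1 by lia.
apply: (@drift_bound_step _ _ L2 j (line_drift W (c + j%:Z)) (line_drift W (c + j.+1%:Z))) => //.
- by rewrite (line_drift_gtN1 PW)// -S.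
- by rewrite (line_drift_lt1 PW)// -S1.
- by have := line_drift_lower PW (n := c + j.+1%:Z); rewrite -S1; apply.
- by have := line_drift_ineq PW (n := c + j.+1%:Z); rewrite -S1 -S; apply.
Qed.

(** The drift bounds put into [line_mass_step] bound each one-step mass ratio by
    [((j + 2) / (j + 1)) ^ L], and the product telescopes. *)
Lemma rooted_mass_growth (i j : nat) : (i <= j)%N ->
  line_mass W (c + j%:Z) <= (j.+1%:R / i.+1%:R) `^ L * line_mass W (c + i%:Z).
Proof.
elim: j => [|j IH].
  by rewrite leqn0 => /eqP ->; rewrite divff// powR1 mul1r.
rewrite leq_eqVlt => /predU1P[->|].
  by rewrite divff ?pnatr_eq0// powR1 mul1r.
rewrite ltnS => /IH {}IH.
have Q0 := rooted_mem Pr Pc j; have Q1 := rooted_mem Pr Pc j.+1.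
have S : c + j.+1%:Z = c + j%:Z + 1 by lia.
have E : line_mass W (c + j.+1%:Z) * (1 - line_drift W (c + j.+1%:Z)) =
   line_mass W (c + j%:Z) * (1 + line_drift W (c + j%:Z)).
  by rewrite S line_mass_step// -S.
have b1 : drift_bound L j.+1 < 1.
  rewrite /drift_bound ltr_pdivrMr; have : 1 <= j.+1%:R :> R by rewrite ler1n.
    by have := L2; lra.
  by have := L2; lra.
have M0 := line_mass_gt0 PW Q0; have M1 := line_mass_gt0 PW Q1.
have d0 := rooted_drift_le j; have d1 := rooted_drift_le j.+1.
apply: (@le_trans _ _ ((j.+2%:R / j.+1%:R) `^ L * line_mass W (c + j%:Z))).
  apply: (@le_trans _ _ ((1 + drift_bound L j) / (1 - drift_bound L j.+1) * line_mass W (c + j%:Z))).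
    rewrite mulrAC ler_pdivlMr ?subr_gt0//.
    apply: (@le_trans _ _ (line_mass W (c + j.+1%:Z) * (1 - line_drift W (c + j.+1%:Z)))).
      by rewrite ler_pM2l//; lra.
    by rewrite E mulrC ler_pM2r//; lra.
  by rewrite ler_pM2r// drift_bound_ratio_le_powR.
apply: (@le_trans _ _ ((j.+2%:R / j.+1%:R) `^ L * ((j.+1%:R / i.+1%:R) `^ L * line_mass W (c + i%:Z)))).
  by rewrite ler_wpM2l// powR_ge0.
by rewrite mulrA -powRM// mulrA divfK ?pnatr_eq0.
Qed.

Lemma rooted_mass_doubling (i j : nat) : (j.+1 <= i.+1.*2)%N ->
  line_mass W (c + j%:Z) <= 2 `^ L * line_mass W (c + i%:Z).
Proof.
move=> ji; have M0 := line_mass_ge0 PW (c + i%:Z).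
have [ij|ij] := leqP i j.
  apply: (le_trans (rooted_mass_growth ij)).
  rewrite ler_wpM2r// ge0_ler_powR ?nnegrE//; first by have := L2; lra.
  by rewrite ler_pdivrMr// -natrM ler_nat mul2n.
apply: (@le_trans _ _ (1 * line_mass W (c + i%:Z))).
  by rewrite mul1r line_mass_homo// lerD2l lez_nat ltnW.
have : 2 `^ 0 <= 2 `^ L :> R by rewrite ler_powR ?ler1n//; have := L2; lra.
by rewrite powRr0; exact: ler_wpM2r.
Qed.

End Rooted.

End HalfLine.

(** * Sums over integer balls *)

Section BallSums.
Variable R : realType.
Implicit Types (F : nat -> R) (M : int -> R).

Lemma ler_sum_ord F m n : (forall i, 0 <= F i) -> (m <= n)%N ->
  \sum_(i < m) F i <= \sum_(i < n) F i.
Proof.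
move=> F0 /subnKC <-; rewrite big_split_ord/= lerDl.
by apply: sumr_ge0.
Qed.

Lemma ler_sum_double F (C : R) n :
    (forall i, F i.*2 <= C * F i) -> (forall i, F i.*2.+1 <= C * F i) ->
  \sum_(i < n.*2) F i <= 2 * C * \sum_(i < n) F i.
Proof.
move=> F0 F1; elim: n => [|n IH]; first by rewrite !big_ord0 mulr0.
rewrite doubleS !big_ord_recr/=; have := F0 n; have := F1 n; lra.
Qed.

(** Runs over all integers of the ball, indexed from its left end; integers that are not vertices
    will have mass 0. *)
Definition ball_sum M (x : int) (k : nat) : R :=
  \sum_(j < k.*2.+1) M (x - k%:Z + j%:Z).

Lemma ball_sum_reflect M x k : ball_sum (fun n => M (- n)) (- x) k = ball_sum M x k.
Proof.
rewrite /ball_sum (reindex_inj rev_ord_inj)/=; apply: eq_bigr => j _.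
by congr (M _); have := ltn_ord j; lia.
Qed.

Lemma ball_sum_le M x k l : (forall n, 0 <= M n) -> (k <= l)%N ->
  ball_sum M x k <= ball_sum M x l.
Proof.
move=> M0 /subnK <-; elim: (l - k)%N => [//|d IH].
apply: (le_trans IH); rewrite addSn /ball_sum doubleS [leRHS]big_ord_recl [in leRHS]big_ord_recr/=.
set T := \sum_(i < _) _; set T' := \sum_(i < _) _.
have -> : T = T' by apply: eq_bigr => i _; congr (M _); rewrite /bump; lia.
have := M0 (x - (d + k).+1%:Z + 0); have := M0 (x - (d + k).+1%:Z + (bump 0 (d + k).*2.+1)%:Z).
lra.
Qed.

Lemma ball_sum_shift M x k (C : R) : 0 <= C -> (forall n, 0 <= M n) ->
    (forall m n, m <= n -> M m <= M n) ->
    (forall i : nat, M (x + i%:Z + k.+1%:Z) <= C * M (x + i%:Z)) ->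
  ball_sum M x k.*2.+1 <= (2 + C) * ball_sum M x k.
Proof.
move=> C0 M0 Mle MC; rewrite {1}/ball_sum.
(* Left part, inner ball of radius [k], right part. *)
have -> : k.*2.+1.*2.+1 = (k.+1 + (k.*2.+1 + k.+1))%N by lia.
rewrite !big_split_ord/=.
rewrite (_ : (2 + C) * _ = ball_sum M x k + (ball_sum M x k + C * ball_sum M x k)); last by lra.
apply: lerD; last apply: lerD.
(* Moving right by [k + 1] lands on [x - k, ..., x] and does not decrease [M]. *)
- apply: (@le_trans _ _ (\sum_(i < k.+1) M (x - k%:Z + i%:Z))).
    by apply: ler_sum => i _; apply: Mle; lia.
  by apply: (@ler_sum_ord (fun i => M (x - k%:Z + i%:Z))) => //; lia.
- by rewrite le_eqVlt; apply/orP; left; apply/eqP/eq_bigr => i _; congr (M _); lia.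
(* Moving left by [k + 1] lands on [x, ..., x + k] at the cost of a factor [C]. *)
- apply: (@le_trans _ _ (\sum_(i < k.+1) C * M (x + i%:Z))).
    apply: ler_sum => i _; apply: le_trans (MC i).
    by rewrite le_eqVlt; apply/orP; left; apply/eqP; congr (M _); lia.
  rewrite -mulr_sumr ler_wpM2l// /ball_sum.
  have -> : k.*2.+1 = (k + k.+1)%N by lia.
  rewrite big_split_ord/= -[leLHS]add0r lerD ?sumr_ge0//.
  by rewrite le_eqVlt; apply/orP; left; apply/eqP/eq_bigr => i _; congr (M _); lia.
Qed.

Lemma ball_sum_rooted M c (X k : nat) : (forall n, n < c -> M n = 0) -> (X <= k)%N ->
  ball_sum M (c + X%:Z) k = \sum_(i < X + k.+1) M (c + i%:Z).
Proof.
move=> M0 Xk; rewrite /ball_sum.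
(* The first [k - X] indices lie to the left of [c]. *)
have -> : k.*2.+1 = ((k - X) + (X + k.+1))%N by lia.
rewrite big_split_ord/= big1 ?add0r; last by move=> i _; apply: M0; have := ltn_ord i; lia.
by apply: eq_bigr => i _; congr (M _); lia.
Qed.

End BallSums.

(** * Doubling for the integer model *)

Section LineDoubling.
Variables (R : realType) (L : R).
Hypothesis L2 : 2 <= L.
Let kap : R := L / (L + 2).

Let powL : 2 <= 2 `^ L :> R.
Proof.
have : 2 `^ 1 <= 2 `^ L :> R by rewrite ler_powR ?ler1n//; have := L2; lra.
by rewrite powRr1.
Qed.

Lemma line_doubling_right (P : pred int) (W : int -> R) x k : line_CD kap P W ->
    (forall n, P n -> P (n + 1)) -> P x ->
  ball_sum (line_mass W) x k.*2.+1 <= 2 * 2 `^ L * ball_sum (line_mass W) x k.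
Proof.
move=> PW Pr Px.
have M0 := line_mass_ge0 PW; have Mle := line_mass_homo L2 PW Pr.
have B0 : 0 <= ball_sum (line_mass W) x k by apply: sumr_ge0.
have C2 : 2 + 2 `^ L <= 2 * 2 `^ L :> R by have := powL; lra.
(* Either there is a first vertex [c], or the line is infinite in both directions. *)
have [[c Pc Pc1]|/forall2NP Pl] := pselect (exists2 c, P c & ~~ P (c - 1)).
  have cx := rooted_ge Pr Pc1 Px.
  have [X xE] : exists X : nat, x = c + X%:Z by exists (absz (x - c)%R); lia.
  have [kX|Xk] := leqP k X.
    apply: (@le_trans _ _ ((2 + 2 `^ L) * ball_sum (line_mass W) x k)); last first.
      by rewrite ler_wpM2r.
    (* Doubling requires [(X + i + k + 1) + 1 <= 2 (X + i + 1)], that is [k <= X + i]. *)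
    apply: ball_sum_shift => // i.
    rewrite xE -!addrA -!PoszD; apply: (rooted_mass_doubling L2 PW Pr Pc) => //.
    by lia.
  have Mz (n : int) : n < c -> line_mass W n = 0.
    by move=> nc; apply: (line_mass_eq0 PW); apply/negP => /(rooted_ge Pr Pc1); lia.
  rewrite xE !ball_sum_rooted//; try lia.
  (* The large ball has [X + 2 k + 2] vertices, at most twice the [X + k + 1] of the small one. *)
  apply: (@le_trans _ _ (\sum_(i < (X + k.+1).*2) line_mass W (c + i%:Z))).
    by apply: (@ler_sum_ord _ (fun i => line_mass W (c + i%:Z))) => //; lia.
  by apply: (@ler_sum_double _ (fun i => line_mass W (c + i%:Z))) => i;
    apply: (rooted_mass_doubling L2 PW Pr Pc); lia.
have {}Pl n : P n -> P (n - 1) by case: (Pl n) => // /negP; rewrite negbK.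
(* With two infinite ends, the drift and its reflection are both nonnegative. *)
have D0 n : P n -> line_drift W n = 0.
  move=> Pn; apply/eqP; rewrite eq_le (line_drift_ge0 L2 PW Pr Pn) andbT.
  rewrite -oppr_ge0 -[n]opprK -line_drift_reflect.
  apply: (line_drift_ge0 L2 (line_CD_reflect PW)); last by rewrite opprK.
  by move=> m; rewrite opprD; exact: Pl.
have MS n : P n -> line_mass W (n + 1) = line_mass W n.
  move=> Pn; have := line_mass_step PW Pn (Pr _ Pn).
  by rewrite !D0 ?Pr// subr0 addr0 !mulr1.
have Pi (i : nat) n : P n -> P (n + i%:Z).
  elim: i => [|i IH] Pn; first by rewrite addr0.
  by rewrite intS [1 + _]addrC addrA Pr// IH.
have Mi (i : nat) n : P n -> line_mass W (n + i%:Z) = line_mass W n.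
  elim: i => [|i IH] Pn; first by rewrite addr0.
  by rewrite intS [1 + _]addrC addrA MS ?IH// Pi.
apply: (@le_trans _ _ ((2 + 2 `^ L) * ball_sum (line_mass W) x k)); last first.
  by rewrite ler_wpM2r.
apply: ball_sum_shift => // i.
rewrite Mi ?Pi// ler_peMl//; have := powL; lra.
Qed.

Lemma line_doubling (P : pred int) (W : int -> R) x k : line_CD kap P W ->
    (forall n, P n -> P (n + 1)) \/ (forall n, P n -> P (n - 1)) -> P x ->
  ball_sum (line_mass W) x k.*2.+1 <= 2 * 2 `^ L * ball_sum (line_mass W) x k.
Proof.
move=> PW [Pr|Pl] Px; first exact: (line_doubling_right k PW).
have H : line_mass (reflect_edge W) = fun n => line_mass W (- n).
  by apply: funext => n; exact: line_mass_reflect.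
have := @line_doubling_right _ _ (- x) k (line_CD_reflect PW).
rewrite H !ball_sum_reflect; apply; last by rewrite opprK.
by move=> n; rewrite opprD; exact: Pl.
Qed.

End LineDoubling.

(** * Transfer of a linear graph to the integers *)

Section LinearGraph.
Variables (R : realType) (I : interval R) (G : wgraph R (int_in I)).
Local Notation V := (int_in I).
Implicit Types (x y : V) (n : int) (F H : int -> R).

Definition in_line : pred int := fun n => (n%:~R : R) \in I.

Definition line_extend (h : V -> R) n : R := oapp h 0 (insub n : option V).

Definition line_edge n : R :=
  if insub n is Some u then line_extend (weight G u) (n + 1) else 0.

Lemma in_line_convex m n k : in_line m -> in_line n -> m <= k -> k <= n -> in_line k.
Proof.
move=> mI nI mk kn.
by apply: (interval_is_interval mI nI); rewrite !ler_int mk.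
Qed.

Lemma line_extend_sval h x : line_extend h (sval x) = h x.
Proof. by rewrite /line_extend -[sval x]/(val x) valK. Qed.

Lemma line_extend_out h n : ~~ in_line n -> line_extend h n = 0.
Proof. by move=> nI; rewrite /line_extend insubN. Qed.

Lemma in_lineP n : in_line n -> exists x : V, n = sval x.
Proof. by move=> nI; exists (exist _ n nI). Qed.

Lemma set_sval_mem (s : seq int) :
  [set y : V | sval y \in s] = [set` pmap (insub : int -> option V) s].
Proof. by apply/seteqP; split=> y /=; rewrite mem_pmap_sub. Qed.

Lemma fsbig_line (s : seq int) (h : V -> R) : uniq s ->
  \sum_(y \in [set y : V | sval y \in s]) h y = \sum_(n <- s) line_extend h n.
Proof.
move=> us; rewrite set_sval_mem -fsbig_seq ?pmap_sub_uniq//.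
elim: s {us} => [|n s IH]; first by rewrite !big_nil.
rewrite big_cons /= -IH /line_extend; case: insub => [y|]/=; first by rewrite big_cons.
by rewrite add0r.
Qed.

Hypothesis Glin : linear_graph G.

Lemma linear_neighbours x :
  [set y | adj G x y] = [set y : V | sval y \in [:: sval x + 1; sval x - 1]].
Proof.
apply/seteqP; split=> y /=; rewrite Glin !inE => /orP[] /eqP yx; apply/orP;
  [left|right|left|right]; apply/eqP; move: (sval x) (sval y) yx => u v; lia.
Qed.

(** The two-term formula also holds at an end vertex, since [line_edge] vanishes at a missing
    edge. *)
Lemma linear_neighbour_sum x F :
  \sum_(y \in [set y | adj G x y]) (weight G x y * F (sval y)) =
  line_edge (sval x) * F (sval x + 1) + line_edge (sval x - 1) * F (sval x - 1).
Proof.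
rewrite linear_neighbours fsbig_line; last by rewrite /= inE; apply/andP; split=> //; lia.
rewrite !big_cons big_nil addr0 /line_edge.
rewrite -[sval x]/(val x) valK /= /line_extend subrK valK.
congr (_ + _); case: insubP => [y _ <-|_]/=; rewrite ?mul0r//.
by rewrite weight_sym.
Qed.

Lemma line_edge_present_gt0 n : in_line n -> in_line (n + 1) -> 0 < line_edge n.
Proof.
move=> /in_lineP[x ->] /in_lineP[y xy]; rewrite /line_edge -[sval x]/(val x) valK.
by rewrite [val x + 1]xy line_extend_sval; apply: weight_gt0; rewrite Glin xy eqxx.
Qed.

Lemma line_edge_missing n : ~~ (in_line n && in_line (n + 1)) -> line_edge n = 0.
Proof.
rewrite negb_and /line_edge => /orP[nI|nI]; first by rewrite insubN.
by case: insub => // u; rewrite line_extend_out.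
Qed.

Hypothesis Gnorm : normalized G.

Lemma mass_line x : mass G x = line_mass line_edge (sval x).
Proof.
rewrite Gnorm; have := linear_neighbour_sum x (fun=> 1).
by rewrite !mulr1 /line_mass => <-; apply: eq_fsbigr => y _; rewrite mulr1.
Qed.

(** * Laplacian and curvature form on the integers *)

Let p n : R := line_edge n / line_mass line_edge n.
Let q n : R := line_edge (n - 1) / line_mass line_edge n.

(** [p] and [q] are the probabilities of a step to the right and to the left. They vanish at missing
    edges, so the operator can act on functions of all integers. *)
Definition line_laplacian F n : R := p n * (F (n + 1) - F n) + q n * (F (n - 1) - F n).

Definition line_carre F H n : R :=
  2^-1 * (line_laplacian (fun z => F z * H z) n
          - F n * line_laplacian H n - H n * line_laplacian F n).

Definition line_carre2 F n : R :=
  2^-1 * line_laplacian (line_carre F F) n - line_carre F (line_laplacian F) n.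

Lemma laplacian_line F x :
  laplacian G (fun y => F (sval y)) x = line_laplacian F (sval x).
Proof.
rewrite /laplacian (linear_neighbour_sum x (fun n => F n - F (sval x))) mass_line.
by rewrite /line_laplacian /p /q; lra.
Qed.

Lemma carre_line F H x :
  carre G (fun y => F (sval y)) (fun y => H (sval y)) x = line_carre F H (sval x).
Proof. by rewrite /carre (laplacian_line (fun n => F n * H n)) !laplacian_line. Qed.

Lemma carre2_line F x : carre2 G (fun y => F (sval y)) x = line_carre2 F (sval x).
Proof.
rewrite /carre2 /line_carre2.
have -> : laplacian G (fun y => F (sval y)) = fun y => line_laplacian F (sval y).
  by apply: funext => y; exact: laplacian_line.
have -> : carre G (fun y => F (sval y)) (fun y => F (sval y)) =
    fun y => line_carre F F (sval y).
  by apply: funext => y; exact: carre_line.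
by rewrite laplacian_line carre_line.
Qed.

Lemma in_line_mass_gt0 n : in_line n -> 0 < line_mass line_edge n.
Proof. by move=> /in_lineP[x ->]; rewrite -mass_line mass_gt0. Qed.

Let pq1 n : in_line n -> p n + q n = 1.
Proof.
move=> nI; rewrite /p /q -mulrDl -/(line_mass line_edge n) divff// gt_eqF//.
exact: in_line_mass_gt0.
Qed.

(** The test function [F] is 0 at [n], [a, 2 a] to the right and [b, 2 b] to the left. Then
    [Delta Gamma(F)] vanishes at [n], and the right side is [2 (Gamma_2(F) - (Delta F)^2 / D)]
    there. *)
Lemma CD_line (D : R) n (a b : R) : 0 < D -> CD G 0 D%:E -> in_line n ->
  0 <= p n * a ^+ 2 * - line_drift line_edge (n + 1)
       + q n * b ^+ 2 * line_drift line_edge (n - 1)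
       + (D - 2) / D * (p n * a + q n * b) ^+ 2.
Proof.
move=> D0 GCD nI; have [x nx] := in_lineP nI.
pose F (z : int) : R := if n <= z then a * (z - n)%:~R else b * (n - z)%:~R.
have := GCD x (fun y => F (sval y)); rewrite mul0r addr0 /inv_dim.
rewrite carre2_line laplacian_line -nx.
have F0 : F n = 0 by rewrite /F lexx subrr mulr0.
have F1 : F (n + 1) = a by rewrite /F ifT ?[_ - n]addrAC ?subrr ?add0r ?mulr1//; lia.
have F2 : F (n + 1 + 1) = 2 * a.
  rewrite /F ifT; last by lia.
  by rewrite (_ : n + 1 + 1 - n = 2) 1?mulrC//; lia.
have G1 : F (n - 1) = b.
  rewrite /F ifF; last by lia.
  by rewrite (_ : n - (n - 1) = 1) ?mulr1//; lia.
have G2 : F (n - 1 - 1) = 2 * b.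
  rewrite /F ifF; last by lia.
  by rewrite (_ : n - (n - 1 - 1) = 2) 1?mulrC//; lia.
have d1 : line_drift line_edge (n + 1) = p (n + 1) - q (n + 1) by rewrite -mulrBl.
have d2 : line_drift line_edge (n - 1) = p (n - 1) - q (n - 1) by rewrite -mulrBl.
(* The factor [p n] covers the case where [n + 1] is not a vertex. *)
have s1 : p n * (p (n + 1) + q (n + 1) - 1) = 0.
  have [n1|n1] := boolP (in_line (n + 1)); first by rewrite pq1// subrr mulr0.
  by rewrite /p (@line_edge_missing n) ?mul0r// (negbTE n1) andbF.
have s2 : q n * (p (n - 1) + q (n - 1) - 1) = 0.
  have [n1|n1] := boolP (in_line (n - 1)); first by rewrite pq1// subrr mulr0.
  by rewrite /q (@line_edge_missing (n - 1)) ?mul0r// (negbTE n1).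
have s0 := pq1 nI.
rewrite d1 d2 /line_carre2 /line_carre /line_laplacian /=.
rewrite !addrK ?subrK F0 F1 F2 G1 G2.
have -> : (D - 2) / D = 1 - 2 * D^-1 by field; rewrite gt_eqF.
move: s0 s1 s2; set P0 := p n; set Q0 := q n.
move: (p (n + 1)) (q (n + 1)) (p (n - 1)) (q (n - 1)) P0 Q0 (D^-1).
move=> P1 Q1 P2 Q2 P0 Q0 d s0 s1 s2.
(* These multiples of the normalizations make the remaining inequality linear in its monomials. *)
have e1 : a ^+ 2 * (P0 * (P1 + Q1 - 1)) = 0 by rewrite s1 mulr0.
have e2 : b ^+ 2 * (Q0 * (P2 + Q2 - 1)) = 0 by rewrite s2 mulr0.
have e0 : (P0 + Q0 - 1) * (P0 * a ^+ 2 + Q0 * b ^+ 2) = 0 by rewrite s0 subrr mul0r.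
lra.
Qed.

Lemma line_CD_of_CD (D : R) : 2 < D -> CD G 0 D%:E ->
  line_CD ((D - 2) / D) in_line line_edge.
Proof.
move=> D2 GCD; have D0 : 0 < D by lra.
have k0 : 0 < (D - 2) / D by rewrite divr_gt0//; lra.
have pE n : in_line n -> p n = (1 + line_drift line_edge n) / 2.
  move=> nI; have := in_line_mass_gt0 nI; rewrite /line_drift /p /line_mass => M0.
  by field; rewrite gt_eqF.
have qE n : in_line n -> q n = (1 - line_drift line_edge n) / 2.
  move=> nI; have := in_line_mass_gt0 nI; rewrite /line_drift /q /line_mass => M0.
  by field; rewrite gt_eqF.
have p0 n : in_line n -> in_line (n + 1) -> 0 < p n.
  by move=> nI n1I; rewrite divr_gt0 ?line_edge_present_gt0 ?in_line_mass_gt0.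
have q0 n : in_line n -> in_line (n - 1) -> 0 < q n.
  by move=> nI n1I; rewrite divr_gt0 ?line_edge_present_gt0 ?in_line_mass_gt0// subrK.
have Q n a b := @CD_line D n a b D0 GCD.
split=> [n|n|n|n nI n1I|n nI n1I|n nI n1I n2I].
- exact: line_edge_present_gt0.
- exact: line_edge_missing.
- exact: in_line_mass_gt0.
(* Slopes [(1, 0)] and then [(0, 1)] give the diagonal coefficients. *)
- have := Q n 1 0 nI; have P0 := p0 n nI n1I.
  have -> : p n * 1 ^+ 2 * - line_drift line_edge (n + 1) +
     q n * 0 ^+ 2 * line_drift line_edge (n - 1) + (D - 2) / D * (p n * 1 + q n * 0) ^+ 2 =
     p n * ((D - 2) / D * p n - line_drift line_edge (n + 1)) by ring.
  by rewrite pmulr_rge0// pE//; lra.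
- have := Q n 0 1 nI; have P0 := q0 n nI n1I.
  have -> : p n * 0 ^+ 2 * - line_drift line_edge (n + 1) +
     q n * 1 ^+ 2 * line_drift line_edge (n - 1) + (D - 2) / D * (p n * 0 + q n * 1) ^+ 2 =
     q n * ((D - 2) / D * q n + line_drift line_edge (n - 1)) by ring.
  by rewrite pmulr_rge0// qE//; lra.
- have P0 := p0 n n1I n2I; have Q0 := q0 n n1I nI.
  have := Q n ^~ 1.
  move: (pE n n1I) (qE n n1I) k0 P0 Q0.
  move: (p n) (q n) ((D - 2) / D) (line_drift line_edge n).
  move: (line_drift line_edge (n + 1)) (line_drift line_edge (n - 1)).
  move=> w u P0 Q0 k v pv qv k0 Pp Qp H.
  (* The form at slopes [(t, 1)], as a polynomial in [t]; it is nonnegative, so its discriminant is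
     at most 0. *)
  pose r := Poly [:: Q0 * u + k * Q0 ^+ 2; 2 * k * P0 * Q0; P0 * - w + k * P0 ^+ 2].
  have r3 : (size r <= 3)%N by exact: size_Poly.
  have := @deg_le2_poly_ge0 _ r r3.
  rewrite !coef_Poly /= => /(_ _)/wrap[].
    by move=> t; rewrite horner_Poly /=; have := H t n1I; lra.
  move=> disc.
  (* The [k ^ 2] terms of the discriminant cancel, leaving the positive factor [P0 Q0]. *)
  have : 0 <= P0 * Q0 * (- (w * u) + k * (u * P0 - w * Q0)) by lra.
  rewrite pmulr_rge0 ?mulr_gt0// pv qv; lra.
Qed.

(** * Infinite ends, distances and volumes *)

Lemma in_line_unbounded : infinite_set [set: V] ->
  (forall n, in_line n -> in_line (n + 1)) \/ (forall n, in_line n -> in_line (n - 1)).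
Proof.
move=> Vinf; apply: contrapT => /not_orP[/existsNP[m /not_implyP[mI m1]]].
move=> /existsNP[l /not_implyP[lI l1]]; apply: Vinf.
(* By convexity, [m] is the last vertex and [l] the first, so only finitely many remain. *)
have le_m n : in_line n -> n <= m.
  move=> nI; rewrite leNgt; apply/negP => mn; apply: m1.
  by apply: (in_line_convex mI nI); lia.
have ge_l n : in_line n -> l <= n.
  move=> nI; rewrite leNgt; apply/negP => mn; apply: l1.
  by apply: (in_line_convex nI lI); lia.
pose s := [seq l + j%:Z | j <- iota 0 (absz (m - l)%R).+1].
suff -> : [set: V] = [set y : V | sval y \in s] by rewrite set_sval_mem; exact: finite_seq.
apply/seteqP; split=> // y _ /=.
have yI : in_line (sval y) := svalP y.
have ly := ge_l _ yI; have ym := le_m _ yI; have lm := le_trans ly ym.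
apply/mapP; exists (absz (sval y - l)%R); first by rewrite mem_iota; move: (sval y) ly ym => u; lia.
by move: (sval y) ly => u; lia.
Qed.

Lemma walk_dist x y (n : nat) : walk (adj G) x y n -> (absz (sval y - sval x)%R <= n)%N.
Proof.
move=> [s [xs <- <-]]; elim: s x xs => [|z s IH] x /=; first by rewrite subrr.
move=> /andP[xz /IH {}IH]; move: xz IH; rewrite Glin.
have step (u v w : int) (k : nat) : (v == u + 1) || (u == v + 1) ->
    (absz (w - v)%R <= k)%N -> (absz (w - u)%R <= k.+1)%N by move=> /orP[] /eqP ->; lia.
exact: step.
Qed.

Lemma walk_exists x y : walk (adj G) x y (absz (sval y - sval x)%R).
Proof.
move kE : (absz _) => k; elim: k x kE => [|k IH] x kE.
  exists [::]; split=> //=; apply: val_inj => /=; move: (sval x) (sval y) kE => u v; lia.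
have xI : in_line (sval x) := svalP x; have yI : in_line (sval y) := svalP y.
have [z xz zy] : exists2 z : V, adj G x z & absz (sval y - sval z)%R = k.
  have [xy|yx] := leP (sval x) (sval y).
    have /in_lineP[z zE] : in_line (sval x + 1).
      by apply: (in_line_convex xI yI); move: (sval x) (sval y) kE xy => u v; lia.
    exists z; first by rewrite Glin zE eqxx.
    by rewrite -zE; move: (sval x) (sval y) kE xy => u v; lia.
  have /in_lineP[z zE] : in_line (sval x - 1).
    by apply: (in_line_convex yI xI); move: (sval x) (sval y) kE yx => u v; lia.
  exists z; first by rewrite Glin -zE subrK eqxx orbT.
  by rewrite -zE; move: (sval x) (sval y) kE yx => u v; lia.
have [s [zs ls ss]] := IH z zy.
by exists (z :: s); split=> //=; rewrite ?xz ?ss.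
Qed.

Lemma gdist_line x y : gdist G x y = absz (sval y - sval x)%R.
Proof.
rewrite /gdist; case: ex_minnP => k /asboolP kw kmin.
apply/eqP; rewrite eqn_leq walk_dist// andbT.
by apply: kmin; apply/asboolP; exact: walk_exists.
Qed.

(** Distances are integers, so only the integer part of [r] matters. *)
Lemma vol_gball x (r : R) : 0 <= r ->
  vol G (gball G r x) = (ball_sum (line_mass line_edge) (sval x) (Num.truncn r))%:E.
Proof.
move=> r0; pose k := Num.truncn r.
pose s := [seq sval x - k%:Z + j%:Z | j <- iota 0 k.*2.+1].
have us : uniq s by rewrite map_inj_uniq ?iota_uniq// => i j /addrI [].
have -> : gball G r x = [set y : V | sval y \in s].
  apply/seteqP; split=> y /=; rewrite /gball /= gdist_line -truncn_ge_nat// -/k => H.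
    apply/mapP; exists (absz (sval y - (sval x - k%:Z))%R).
      by rewrite mem_iota; move: (sval x) (sval y) H => u v; lia.
    by move: (sval x) (sval y) H => u v; lia.
  move: H => /mapP[j]; rewrite mem_iota => jk ->; move: (sval x) => u; lia.
rewrite /vol esum_fset; last 2 first.
- by rewrite set_sval_mem; exact: finite_seq.
- by move=> y _; rewrite lee_fin ltW// mass_gt0.
rewrite fsumEFin; last by rewrite set_sval_mem; exact: finite_seq.
rewrite fsbig_line// big_map; congr _%:E.
rewrite /ball_sum -(big_mkord xpredT (fun j => line_mass line_edge (sval x - k%:Z + j%:Z))).
rewrite /index_iota subn0; apply: eq_bigr => j _.
have [nI|nI] := boolP (in_line (sval x - k%:Z + j%:Z)).
  by have [y yE] := in_lineP nI; rewrite yE line_extend_sval mass_line.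
rewrite line_extend_out// /line_mass !line_edge_missing ?addr0//.
  by rewrite subrK (negbTE nI) andbF.
by rewrite (negbTE nI).
Qed.

End LinearGraph.

Theorem corollary1p11 (R : realType) (I : interval R)
    (G : wgraph R (int_in I)) (D : R)
    (Vinf : infinite_set [set: int_in I])
    (Glin : linear_graph G) (Gnorm : normalized G)
    (D4 : 4 <= D) (GCD : CD G 0 D%:E) :
  volume_doubling G (2 `^ (D - 1)).
Proof.
move=> x r r0.
have D2 : 2 < D by lra.
have L2 : 2 <= D - 2 by lra.
have PW := line_CD_of_CD Glin Gnorm D2 GCD.
(* The integer model is used with [L = D - 2]. *)
have kE : (D - 2) / D = (D - 2) / (D - 2 + 2) by rewrite subrK.
rewrite !vol_gball ?mulr_ge0// -EFinM lee_fin.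
have -> : 2 `^ (D - 1) = 2 * 2 `^ (D - 2) :> R.
  rewrite -{2}(powRr1 (_ : 0 <= 2 :> R))// -powRD; last by rewrite pnatr_eq0 implybT.
  by congr (_ `^ _); lra.
rewrite kE in PW.
apply: le_trans (line_doubling L2 _ PW (in_line_unbounded Vinf) (svalP x)).
apply: ball_sum_le; first exact: line_mass_ge0 PW.
(* With [k] the integer part of [r], [2 r < 2 k + 2], so the integer part of [2 r] is at most
   [2 k + 1]. *)
have : r < (Num.truncn r).+1%:R by rewrite -truncn_le_nat.
rewrite truncn_le_nat -!doubleS -mul2n natrM; lra.
Qed.
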